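(* Let $(T,X,\pi)$ be a topological flow on a Polish space $X$ with $T$ an abelian discrete group. If $(T,X,\pi)$ is Devaney chaotic, then $(T,X,\pi)$ is multi-dimensional Li-Yorke chaotic.
   Context: A topological flow $(T,X,\pi)$ consists of a topological group $T$, a topological space $X$ and a jointly continuous action $\pi\colon T\times X\to X$, $(t,x)\mapsto tx$, with $s(tx)=(st)x$ and $ex=x$, where $e$ is the neutral element. $T$ acts on $X^k$ by $t(x_1,\dots,x_k)=(tx_1,\dots,tx_k)$. $Tx=\{tx : t\in T\}$ and $t^{-1}V=\{x : tx\in V\}$. A subset $B\subseteq T$ is syndetic if there is a compact $K\subseteq T$ with $Kt\cap B\neq\emptyset$ for all $t\in T$. A point $x$ is periodic if $\{t\in T : tx=x\}$ is syndetic in $T$. $(T,X,\pi)$ is Devaney chaotic if (1) it is topologically transitive, i.e. for all nonempty open $U,V\subseteq X$ there is $t\in T$ with $U\cap t^{-1}V\neq\emptyset$; (2) its periodic points are dense in $X$; (3) it is not minimal, where minimal means $\overline{Tx}=X$ for every $x\in X$. $(T,X,\pi)$ is multi-dimensional Li-Yorke chaotic if for every increasing sequence $\{F_n\}_{n\ge1}$ of compact subsets of $T$ there is an uncountable set $\Theta\subseteq X$ such that for any $k\ge2$ and any distinct $x_1,\dots,x_k\in\Theta$ there are sequences $\{s_n\},\{t_n\}$ in $T$ and a point $p\in X$ with $s_n\notin F_n$ for all $n$, $s_n(x_1,\dots,x_k)\to(x_1,\dots,x_k)$ and $t_n(x_1,\dots,x_k)\to(p,\dots,p)$ as $n\to\infty$.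 *)

(* Defs.v *)
From HB Require Import structures.
From mathcomp Require Import all_boot all_order all_algebra.
From mathcomp Require Import all_classical all_reals all_analysis.

Set Implicit Arguments.
Unset Strict Implicit.
Unset Printing Implicit Defensive.

Import Order.TTheory GRing.Theory Num.Theory.
Local Open Scope classical_set_scope.

HB.mixin Record isTopologicalGroup T & Group T & Topological T := {
  mulg_continuous : continuous (fun z : T * T => (z.1 * z.2)%g) ;
  invg_continuous : continuous (fun t : T => t^-1%g)
}.

#[short(type="topologicalGroupType")]
HB.structure Definition TopologicalGroup :=
  {T of Group T & Topological T & isTopologicalGroup T}.

Definition discrete_group (T : topologicalGroupType) := forall A : set T, open A.

Definition abelian_group (T : topologicalGroupType) :=
  forall s t : T, (s * t = t * s)%g.

Definition is_metric (R : realType) (X : Type) (d : X -> X -> R) :=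
  [/\ forall x y, (0 <= d x y)%R,
      forall x y, d x y = 0%R <-> x = y,
      forall x y, d x y = d y x &
      forall x y z, (d x z <= d x y + d y z)%R].

Definition metrizes (R : realType) (X : topologicalType) (d : X -> X -> R) :=
  forall (x : X) (A : set X),
    nbhs x A <-> exists2 e : R, (0 < e)%R & [set y | (d x y < e)%R] `<=` A.

Definition metric_cauchy (R : realType) (X : Type) (d : X -> X -> R)
    (u : nat -> X) :=
  forall e : R, (0 < e)%R ->
    exists N : nat, forall m n : nat,
      (N <= m)%N -> (N <= n)%N -> (d (u m) (u n) < e)%R.

Definition separable_space (X : topologicalType) :=
  exists2 D : set X, countable D & dense D.

Definition completely_metrizable (R : realType) (X : topologicalType) :=
  exists d : X -> X -> R,
    [/\ is_metric d, metrizes d &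
        forall u : nat -> X, metric_cauchy d u ->
          exists l : X, u @ \oo --> l].

Definition polish_space (R : realType) (X : topologicalType) :=
  separable_space X /\ completely_metrizable R X.

Record topological_flow (T : topologicalGroupType) (X : topologicalType) :=
  TopologicalFlow {
    flow_act :> T -> X -> X ;
    flow_continuous : continuous (fun z : T * X => flow_act z.1 z.2) ;
    flow_actM : forall (s t : T) (x : X),
      flow_act s (flow_act t x) = flow_act (s * t)%g x ;
    flow_act1 : forall x : X, flow_act 1%g x = x
  }.

Definition syndetic (T : topologicalGroupType) (B : set T) :=
  exists2 K : set T, compact K &
    forall t : T, [set (k * t)%g | k in K] `&` B !=set0.

Section Flow.
Variables (T : topologicalGroupType) (X : topologicalType).
Variable pi : topological_flow T X.

Definition flow_orbit (x : X) : set X := [set pi t x | t in [set: T]].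

Definition periodic_point (x : X) := syndetic [set t : T | pi t x = x].

Definition topologically_transitive :=
  forall U V : set X, open U -> open V -> U !=set0 -> V !=set0 ->
    exists t : T, U `&` (pi t @^-1` V) !=set0.

Definition minimal_flow := forall x : X, closure (flow_orbit x) = [set: X].

Definition devaney_chaotic :=
  [/\ topologically_transitive, dense periodic_point & ~ minimal_flow].

(* X^k is [{ptws 'I_k -> X}], which carries the product topology. *)
Definition flow_pow (k : nat) (t : T) (x : {ptws 'I_k -> X}) :
  {ptws 'I_k -> X} := fun i => pi t (x i).

Definition diag_point (k : nat) (p : X) : {ptws 'I_k -> X} := fun _ => p.

Definition multidim_li_yorke_chaotic :=
  forall F : nat -> set T,
    (forall n, compact (F n)) ->
    (forall n, F n `<=` F n.+1) ->
    exists2 Theta : set X, ~ countable Theta &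
      forall (k : nat) (x : {ptws 'I_k -> X}),
        (2 <= k)%N -> (forall i, Theta (x i)) ->
        (forall i j, x i = x j -> i = j) ->
        exists (s t : nat -> T) (p : X),
          [/\ forall n, ~ F n (s n),
              (fun n => flow_pow (s n) x) @ \oo --> x &
              (fun n => flow_pow (t n) x) @ \oo --> diag_point p].

End Flow.

(* Main.v *)
Require Import Defs.
From mathcomp Require Import all_boot all_order all_algebra.
From mathcomp Require Import all_classical all_reals all_analysis.
From mathcomp Require Import lra.

Set Implicit Arguments.
Unset Strict Implicit.
Unset Printing Implicit Defensive.

Import Order.TTheory GRing.Theory Num.Theory.
Local Open Scope classical_set_scope.

(** Two facts drive the proof.

    Proximality comes from one periodic point [p0].  Its stabiliser [H] has
    finite index because [T] is discrete, so a point [y0] with dense orbit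
    (Baire) yields finitely many closures of [H]-orbits covering the space, and
    one of them, the closure of [H y], has nonempty interior [W].  Some translate
    [p] of [p0] lies in that closure, and [H] fixes [p] because [T] is abelian.
    Given finitely many open sets meeting [W], pick points [h_i y] in them; an
    element [t] of [H] that brings [y] close enough to [p] brings every [h_i y]
    close to [p], since [t h_i y = h_i t y] and [h_i p = p].  Restricting to [W]
    cannot be avoided: if [T] permutes the pieces of a clopen partition of [X],
    points of different pieces need not be proximal.  This is
    [simultaneous_proximality].

    Recurrence comes from the density of periodic points.  Finitely many of
    them, having finite orbits, are fixed together by infinitely many elements
    of the infinite group [T], hence by one outside any prescribed finite set
    ([simultaneous_recurrence]).

    A Cantor scheme of open subsets of [W] ([cantor_scheme]) alternates the two.
    At stage [n] the [2^n] current open sets shrink so that one element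
    [s_n], outside [F_n], moves all their points by less than [1/(n+1)] and one
    element [t_n] sends all of them within [1/(n+1)] of [p]; then each set is
    split in two, which is possible because a Devaney chaotic flow has no
    isolated points.  The branches of the scheme form an uncountable set on
    which [s_n] converges pointwise to the identity and [t_n] to the constant
    [p].  The same two sequences serve all tuples, and convergence in [X^k] is
    coordinatewise. *)

(** * Choice, counting and topological preliminaries *)

(** Dependent choice in the form used by inductive constructions whose invariant
    [P] and step relation [Q] depend on the stage. *)
Lemma stagewise_choice (S : Type) (P : nat -> S -> Prop)
    (Q : nat -> S -> S -> Prop) (s0 : S) :
  P 0%N s0 -> (forall n s, P n s -> exists s', P n.+1 s' /\ Q n s s') ->
  exists u : nat -> S, forall n, P n (u n) /\ Q n (u n) (u n.+1).
Proof.
move=> P0 step.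
have /choice[next nextP] (ns : nat * S) : exists s', P ns.1 ns.2 ->
    P ns.1.+1 s' /\ Q ns.1 ns.2 s'.
  case: ns => n s /=.
  have [/step[s' ?]|nP] := pselect (P n s); first by exists s'.
  by exists s => /nP.
pose u := fix u n := if n is m.+1 then next (m, u m) else s0.
have Pu n : P n (u n) by elim: n => //= n /(nextP (n, _))[].
by exists u => n; split=> //; have [] := nextP (n, u n) (Pu n).
Qed.

Lemma infinite_fiber (A B : Type) (D : set A) (f : A -> B) :
  infinite_set D -> finite_set (f @` D) ->
  exists b, infinite_set (D `&` f @^-1` [set b]).
Proof.
move=> infD finfD; apply: contrapT => /forallNP fin; apply: infD.
apply: (@sub_finite_set _ _ (\bigcup_(b in f @` D) (D `&` f @^-1` [set b]))).
  by move=> a Da; exists (f a); [exists a|].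
by apply: bigcup_finite => // b _; exact: contrapT (fin b).
Qed.

(** A finite Baire property, valid in every space: if the first closed set does
    not contain [O], remove it from [O] and recurse on the remaining ones. *)
Lemma interior_of_cover (X : topologicalType) (I : eqType) (C : I -> set X)
    (s : seq I) (O : set X) :
  (forall i, closed (C i)) -> open O -> O !=set0 ->
  (forall x, O x -> exists2 i, i \in s & C i x) ->
  exists2 i, i \in s & (C i)^° !=set0.
Proof.
move=> clC; elim: s O => [|i s IH] O oO [x Ox] cov.
  by have [] := cov x Ox.
have [OC|] := pselect (O `<=` C i).
  exists i; first by rewrite mem_head.
  by exists x; apply: filterS OC _; exact: open_nbhs_nbhs.
move=> /existsNP[z /not_implyP[Oz nCz]].
have [||w [Ow nCw]|j js Cj] := IH (O `&` ~` C i).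
- by apply: openI => //; apply: closed_openC.
- by exists z.
- have [j] := cov w Ow; rewrite inE => /orP[/eqP -> //|js] Cjw; by exists j.
by exists j; rewrite // inE js orbT.
Qed.

(** * Complete metric spaces *)

Section MetricSpace.
Variables (R : realType) (X : topologicalType) (d : X -> X -> R).
Hypotheses (metric_d : is_metric d) (metrizes_d : metrizes d).

Let dist0 x : d x x = 0%R.
Proof. by have [_ h _ _] := metric_d; apply/h. Qed.
Let distC x y : d x y = d y x.
Proof. by have [_ _ h _] := metric_d. Qed.
Let dist_tri y x z : (d x z <= d x y + d y z)%R.
Proof. by have [_ _ _ h] := metric_d. Qed.
Let dist_ge0 x y : (0 <= d x y)%R.
Proof. by have [h] := metric_d. Qed.

Lemma dist_gt0 x y : x <> y -> (0 < d x y)%R.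
Proof.
have [_ h _ _] := metric_d => xy; rewrite lt_neqAle dist_ge0 andbT eq_sym.
by apply/eqP => /h.
Qed.

Lemma nbhs_dist_lt x e : (0 < e)%R -> nbhs x [set y | (d x y < e)%R].
Proof. by move=> e0; apply/metrizes_d; exists e. Qed.

Lemma open_dist_lt x e : open [set y | (d x y < e)%R].
Proof.
rewrite openE => y /= xy; apply/metrizes_d; exists (e - d x y)%R.
  by rewrite subr_gt0.
by move=> z /= yz; have := dist_tri y x z; lra.
Qed.

Lemma metric_hausdorff : hausdorff_space X.
Proof.
move=> x y clxy; apply: contrapT => /dist_gt0 xy.
have [z []] := clxy _ _ (nbhs_dist_lt x (e := (d x y / 2)%R) ltac:(lra))
  (nbhs_dist_lt y (e := (d x y / 2)%R) ltac:(lra)).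
by move=> /= h1 h2; have := dist_tri z x y; rewrite (distC z y); lra.
Qed.

Lemma natSinv_eventually_lt e : (0 < e)%R ->
  exists N, forall n, (N <= n)%N -> (n.+1%:R^-1 < e :> R)%R.
Proof.
move=> e0; have [N _ h] := near_infty_natSinv_lt (PosNum e0).
by exists N => n Nn; exact: h.
Qed.

Lemma cvg_of_dist_lt (u : nat -> X) x :
  (forall n, (d (u n) x < n.+1%:R^-1)%R) -> u @ \oo --> x.
Proof.
move=> ux A /metrizes_d[e e0 eA]; have [N hN] := natSinv_eventually_lt e0.
by exists N => // n /hN ne; apply: eA; rewrite /= distC (lt_trans (ux n)).
Qed.

(** The smallness of [V] is a bound on its diameter, so that a nested sequence
    of such sets produces Cauchy sequences. *)
Lemma shrink_nbhs x U e : nbhs x U -> (0 < e)%R ->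
  exists V : set X, [/\ open V, V x, closure V `<=` U &
    forall a b, V a -> V b -> (d a b < e)%R].
Proof.
move=> /metrizes_d[r r0 rU] e0; pose c := (Num.min r e / 2)%R.
have [cr ce c0] : [/\ (c * 2 <= r)%R, (c * 2 <= e)%R & (0 < c)%R].
  rewrite /c; split; rewrite ?mulfVK ?pnatr_eq0 ?ge_min ?lexx ?orbT//.
  by rewrite divr_gt0// lt_min r0.
(* The closure of the ball of radius c lies in the ball of radius 2c <= r. *)
exists [set y | (d x y < c)%R]; split.
- exact: open_dist_lt.
- by rewrite /= dist0.
- move=> z /(_ _ (nbhs_dist_lt z c0))[w /= [xw zw]]; apply: rU => /=.
  by have := dist_tri w x z; rewrite (distC w z); lra.
- by move=> a b /= xa xb; have := dist_tri x a b; rewrite (distC a x); lra.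
Qed.

Hypothesis complete_d : forall u : nat -> X, metric_cauchy d u ->
  exists l : X, u @ \oo --> l.

Lemma nested_intersection (V : nat -> set X) :
  (forall n, V n !=set0) -> (forall n, closure (V n.+1) `<=` V n) ->
  (forall n a b, V n.+1 a -> V n.+1 b -> (d a b < n.+1%:R^-1)%R) ->
  exists x, forall n, V n x.
Proof.
move=> /choice[u uV] clV smallV.
have mono n m : (n <= m)%N -> V m `<=` V n.
  move=> /subnK <-; elim: (m - n)%N => //= k IH x Vx; apply: IH.
  by apply: clV; exact: subset_closure.
(* Only the sets of index at least 1 are small, hence the shift to N.+1. *)
have [l ul] : exists l : X, u @ \oo --> l.
  apply: complete_d => e /natSinv_eventually_lt[N hN]; exists N.+1 => m n Nm Nn.
  apply: lt_trans (hN N (leqnn N)).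
  by apply: smallV; [exact: (mono _ m)|exact: (mono _ n)].
exists l => n; apply: clV => B /ul[N _ hN].
exists (u (maxn N n.+1)); split; last by apply: hN; rewrite /= leq_maxl.
by apply: (mono _ (maxn N n.+1)) => //; rewrite leq_maxr.
Qed.

Lemma baire (x0 : X) (G : nat -> set X) :
  (forall n, open (G n)) -> (forall n, dense (G n)) ->
  exists x, forall n, G n x.
Proof.
move=> oG dG.
have [||V PV] := @stagewise_choice _ (fun _ V => open V /\ V !=set0)
  (fun n V V' => closure V' `<=` V `&` G n /\
     forall a b, V' a -> V' b -> (d a b < n.+1%:R^-1)%R) [set: X].
- by split; [exact: openT | exists x0].
- move=> n V [oV V0]; have [x [Vx Gx]] := dG n V V0 oV.
  have [||V' [oV' V'x clV' smallV']] :=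
    @shrink_nbhs x (V `&` G n) (n.+1%:R^-1)%R.
  + by apply: open_nbhs_nbhs; split=> //; exact: openI.
  + by rewrite invr_gt0.
  by exists V'; do !split=> //; exists x.
have [|||x Vx] := @nested_intersection V.
- by move=> n; have [[]] := PV n.
- by move=> n z /(PV n).2.1[].
- by move=> n; exact: (PV n).2.2.
by exists x => n; have [_] := (PV n).2.1 x (subset_closure (Vx n.+1)).
Qed.

(** Enough of second countability for the transitive point: the balls of
    radius [1/(j+1)] around the points of a countable dense set. *)
Lemma countable_pi_base (x0 : X) : separable_space X ->
  exists B : nat -> set X, (forall n, open (B n) /\ B n !=set0) /\
    forall U, open U -> U !=set0 -> exists n, B n `<=` U.
Proof.
move=> [D /countable_injP[f injf] dD].
have [e eD] : exists e : nat -> X, forall x, D x -> e (f x) = x.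
  have /choice[e eP] n : exists y, forall x, D x -> f x = n -> y = x.
    have [[y [Dy fy]]|nD] := pselect (exists y, D y /\ f y = n).
      by exists y => x Dx fx; apply: injf; rewrite ?inE// fy.
    by exists x0 => x Dx fx; case: nD; exists x.
  by exists e => x Dx; exact: eP.
pose B n := if (unpickle n : option (nat * nat)) is Some ij
  then [set y | (d (e ij.1) y < ij.2.+1%:R^-1)%R] else [set: X].
exists B; split=> [n|U oU [x Ux]].
  rewrite /B; case: (unpickle n) => [[i j]|] /=.
    by split; [exact: open_dist_lt|exists (e i); rewrite /= dist0 invr_gt0].
  by split; [exact: openT|exists x0].
have /metrizes_d[r r0 rU] : nbhs x U by exact: open_nbhs_nbhs.
have [j /(_ j (leqnn j)) jr] :=
  natSinv_eventually_lt (divr_gt0 r0 (ltr0Sn R 1)).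
have j0 : (0 < j.+1%:R^-1 :> R)%R by rewrite invr_gt0.
have [|z [/= xz Dz]] := dD _ _ (open_dist_lt x (j.+1%:R^-1)%R).
  by exists x; rewrite /= dist0.
exists (pickle (f z, j)); rewrite /B pickleK /= eD// => y /= zy.
apply: rU => /=; have := dist_tri z x y.
by move: xz zy jr; move: (_^-1)%R => c xz zy jr; lra.
Qed.

(** Two distinct points [a] and [b] of [O] are separated by balls of radius
    [d a b / 2]; the two pieces are shrunk inside these balls. *)
Lemma split_open O e : open O -> (0 < e)%R ->
  (exists a b, [/\ O a, O b & a <> b]) ->
  exists V : bool -> set X, (forall b, [/\ open (V b), V b !=set0,
      closure (V b) `<=` O & forall x y, V b x -> V b y -> (d x y < e)%R]) /\
    forall x b b', V b x -> V b' x -> b = b'.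
Proof.
move=> oO e0 [a [b [Oa Ob /dist_gt0 ab]]].
have sep c : O c -> exists V : set X, [/\ open V, V c,
    closure V `<=` O `&` [set y | (d c y < d a b / 2)%R] &
    forall x y, V x -> V y -> (d x y < e)%R].
  move=> Oc; apply: shrink_nbhs => //; apply: open_nbhs_nbhs; split.
    by apply: openI => //; exact: open_dist_lt.
  by split=> //=; rewrite dist0; lra.
have [Va [oVa Vaa clVa smallVa]] := sep a Oa.
have [Vb [oVb Vbb clVb smallVb]] := sep b Ob.
have disj x : Va x -> Vb x -> False.
  move=> /subset_closure/clVa[_ /= ax] /subset_closure/clVb[_ /= bx].
  by have := dist_tri x a b; rewrite (distC x b); lra.
exists (fun c => if c then Va else Vb); split=> [[]|x [] []] //.
- by split=> //; [exists a|move=> x /clVa[]].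
- by split=> //; [exists b|move=> x /clVb[]].
- by move=> h1 h2; case: (disj x).
- by move=> h1 h2; case: (disj x).
Qed.

(** Stage [n] of the scheme is a family of open sets indexed by the binary words
    of length [n], stored as a function on all words to keep one type for every
    stage.  A word is read backwards, its head being the last
    choice made, so the children of [s] are [true :: s] and [false :: s].  The
    element [c n] is common to the whole stage, which is what makes it serve
    simultaneously all the limit points.  Branches through disjoint siblings
    have different limits, and Cantor's diagonal argument concludes. *)
Lemma cantor_scheme (S : Type) (E : nat -> S -> X -> Prop) (W : set X) :
  open W -> W !=set0 ->
  (forall O : set X, open O -> O !=set0 ->
    exists a b, [/\ O a, O b & a <> b]) ->
  (forall n (I : finType) (U : I -> set X),
    (forall i, [/\ open (U i), U i !=set0 & U i `<=` W]) ->
    exists (c : S) (V : I -> set X), forall i,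
      [/\ open (V i), V i !=set0, V i `<=` U i & forall x, V i x -> E n c x]) ->
  exists (c : nat -> S) (Theta : set X), ~ countable Theta /\
    forall x, Theta x -> forall n, E n (c n) x.
Proof.
move=> oW W0 perfect refine.
pose P n (U : seq bool -> set X) := forall s, size s = n ->
  [/\ open (U s), U s !=set0 & U s `<=` W].
pose Q n (U U' : seq bool -> set X) := exists c : S, forall s, size s = n ->
  (forall b, [/\ closure (U' (b :: s)) `<=` U s,
      forall x y, U' (b :: s) x -> U' (b :: s) y -> (d x y < n.+1%:R^-1)%R &
      forall x, U' (b :: s) x -> E n c x]) /\
  forall x b b', U' (b :: s) x -> U' (b' :: s) x -> b = b'.
have [||U PU] := @stagewise_choice _ P Q (fun=> W).
- by move=> s _; split.
- move=> n U PU.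
  have [c [V PV]] := refine n _ (fun t : n.-tuple bool => U t)
    (fun t => PU t (size_tuple t)).
  have /choice[V' PV'] (t : n.-tuple bool) : exists V' : bool -> set X,
      (forall b, [/\ open (V' b), V' b !=set0, closure (V' b) `<=` V t &
        forall x y, V' b x -> V' b y -> (d x y < n.+1%:R^-1)%R]) /\
      forall x b b', V' b x -> V' b' x -> b = b'.
    have [oV V0 _ _] := PV t.
    by apply: split_open; rewrite ?invr_gt0//; exact: perfect.
  pose U' s := if s is b :: s' then
    if insub s' is Some t then V' t b else set0 else set0.
  have U'E b (t : n.-tuple bool) : U' (b :: t) = V' t b by rewrite /U' valK.
  exists U'; split.
    case=> // b s [] /eqP sn; rewrite (U'E b (Tuple sn)).
    have [oV' V'0 clV' _] := (PV' (Tuple sn)).1 b.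
    have [_ _ VU _] := PV (Tuple sn).
    have [_ _ UW] := PU _ (eqP sn).
    by split=> // x /subset_closure/clV'/VU/UW.
  exists c => s /eqP sn; split=> [b|x b b'].
    rewrite (U'E b (Tuple sn)).
    have [_ _ clV' smallV'] := (PV' (Tuple sn)).1 b.
    have [_ _ VU VE] := PV (Tuple sn).
    split=> // [x /clV'/VU //|x /subset_closure/clV'/VE //].
  rewrite (U'E b (Tuple sn)) (U'E b' (Tuple sn)).
  exact: (PV' (Tuple sn)).2.
have /choice[c Pc] n := (PU n).2.
pose pre (al : nat -> bool) := fix pre n :=
  if n is m.+1 then al m :: pre m else [::].
have size_pre al n : size (pre al n) = n by elim: n => //= n ->.
have /choice[phi Pphi] al : exists x, forall n, U n (pre al n) x.
  apply: nested_intersection => n.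
  - by have [] := (PU n).1 _ (size_pre al n).
  - by have [] := (Pc n _ (size_pre al n)).1 (al n).
  - by have [] := (Pc n _ (size_pre al n)).1 (al n).
have phi_inj al be : phi al = phi be -> al = be.
  move=> ab; have pre_eq n : pre al n = pre be n.
    elim: n => //= n IH; congr (_ :: _) => //.
    apply: (Pc n _ (size_pre al n)).2 (Pphi al n.+1) _.
    by rewrite ab IH; exact: (Pphi be n.+1).
  by apply/funext => n; have [] := pre_eq n.+1.
exists c, (range phi); split=> [/countable_injP[f injf]|x [al _ <-] n].
  have finj al be : f (phi al) = f (phi be) -> al = be.
    by move=> h; apply/phi_inj/injf; rewrite ?inE.
  (* The diagonal branch: it differs from al at the index f (phi al). *)
  pose be n := `[< exists al, f (phi al) = n /\ al n = false >].
  have : be (f (phi be)) = ~~ be (f (phi be)).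
    case bE : (be (f (phi be))); last first.
      by move: (bE) => /asboolP; case; exists be.
    by move: (bE) => /asboolP[al [/finj ->]]; rewrite bE.
  by case: (be _).
have [_ _] := (Pc n _ (size_pre al n)).1 (al n).
by apply; exact: Pphi.
Qed.

End MetricSpace.

Lemma cvg_coordinatewise (I : Type) (X : topologicalType)
    (u : nat -> {ptws I -> X}) (x : {ptws I -> X}) :
  (forall i, (fun n => u n i) @ \oo --> x i) -> u @ \oo --> x.
Proof.
move=> ux; apply/cvg_sup => i A [_] [[B oB <-] Bxi BA].
apply: filterS BA _; apply: ux; exact: open_nbhs_nbhs.
Qed.

(** If [K] is infinite, the sets containing all but finitely many points of
    [K] form a filter, which has no cluster point in a discrete space. *)
Lemma discrete_compact_finite (T : topologicalGroupType) (K : set T) :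
  discrete_group T -> compact K -> finite_set K.
Proof.
move=> hTd cK; apply: contrapT => infK.
have cofin_filter : ProperFilter [set A : set T | finite_set (K `\` A)].
  split=> /=; first by rewrite setD0.
  split=> /= [|A B finA finB|A B AB]; first by rewrite setDT.
    by rewrite /= setDIr finite_setU.
  by apply: sub_finite_set; exact: setDS.
have [|x [_ /(_ (~` [set x]) [set x])[]]] := cK _ cofin_filter.
- by rewrite /= setDv.
- by rewrite /= setDE setCK; apply: finite_setIr.
- by apply: open_nbhs_nbhs; split=> //; exact: hTd.
- by move=> z [].
Qed.

(** * Flows of discrete groups *)

Section Flow.
Variables (T : topologicalGroupType) (X : topologicalType).
Variable pi : topological_flow T X.
Hypothesis hTd : discrete_group T.

Lemma act_continuous t : continuous (pi t).
Proof.
move=> x; apply: (@continuous_comp _ _ _ (fun y => (t, y))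
  (fun z : T * X => pi z.1 z.2)); last exact: flow_continuous.
by apply: cvg_pair => //; exact: cvg_cst.
Qed.

Lemma actK t x : pi t^-1%g (pi t x) = x.
Proof. by rewrite flow_actM mulVg flow_act1. Qed.

Lemma open_act_preimage t U : open U -> open (pi t @^-1` U).
Proof. by apply: open_comp => x _; exact: act_continuous. Qed.

(** For finite [K], every [t] has some [k] in [K] with [k t x = x], that is
    [t x = k^-1 x]. *)
Lemma periodic_orbit_finite x :
  periodic_point pi x -> finite_set (flow_orbit pi x).
Proof.
move=> [K /(discrete_compact_finite hTd) finK hK].
apply: sub_finite_set (finite_image (fun k => pi k^-1%g x) finK) => _ [t _ <-].
have [_ [[k Kk <-] /= ktx]] := hK t.
by exists k => //; rewrite -[in LHS]ktx -flow_actM actK.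
Qed.

(** The finite orbits and the pigeonhole principle give an infinite set of group
    elements acting identically on [s]; its left translates by inverses of its
    elements fix [s], and they are too many to stay in [F]. *)
Lemma periodic_fixed_outside (F : set T) (s : seq X) :
  (forall q, q \in s -> periodic_point pi q) ->
  infinite_set [set: T] -> finite_set F ->
  exists2 t, ~ F t & forall q, q \in s -> pi t q = q.
Proof.
move=> pers infT finF.
have [D' infD' sameD'] : exists2 D' : set T, infinite_set D' &
    forall q, q \in s -> forall a b, D' a -> D' b -> pi a q = pi b q.
  elim: s pers => [|q s IH] pers; first by exists [set: T].
  have [|D' infD' sameD'] := IH.
    by move=> r rs; apply: pers; rewrite inE rs orbT.
  have [|y infy] := infinite_fiber (f := fun t => pi t q) infD'.
    apply: sub_finite_set (periodic_orbit_finite (pers q (mem_head q s))).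
    by move=> _ [t _ <-]; exists t.
  exists (D' `&` [set t | pi t q = y]) => // r; rewrite inE => /orP[/eqP ->|rs].
    by move=> a b [_ /= ->] [_ /= ->].
  by move=> a b [Da _] [Db _]; exact: sameD'.
have [b D'b] := infinite_setN0 infD'.
have [a D'a nFa] : exists2 a, D' a & ~ F (b^-1 * a)%g.
  apply: contrapT => h; apply: infD'.
  apply: sub_finite_set (finite_image (fun f => (b * f)%g) finF) => a D'a.
  exists (b^-1 * a)%g; last by rewrite mulVKg.
  by apply: contrapT => nF; apply: h; exists a.
exists (b^-1 * a)%g => // q qs.
by rewrite -flow_actM (sameD' q qs a b) // actK.
Qed.

(** A finite orbit is closed, so if it is dense it is the whole space.  This is
    how failure of minimality excludes finite groups and isolated points. *)
Lemma dense_finite_orbit_minimal x : hausdorff_space X ->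
  finite_set (flow_orbit pi x) -> dense (flow_orbit pi x) -> minimal_flow pi.
Proof.
move=> hX fin dx.
have full y : flow_orbit pi x y.
  have cl : closed (flow_orbit pi x).
    by move/accessible_finite_set_closed: (hausdorff_accessible hX); apply.
  apply: contrapT => ny.
  by have [||z [nz /nz]] := dx (~` flow_orbit pi x);
    [exists y|exact: closed_openC|].
move=> y; apply/seteqP; split=> // z _; apply: subset_closure.
have [[a _ <-] [b _ <-]] := (full y, full z).
by exists (b * a^-1)%g => //; rewrite -flow_actM actK.
Qed.

End Flow.

(** * Consequences of Devaney chaos *)

Section Transitive.
Variables (R : realType) (T : topologicalGroupType) (X : topologicalType).
Variable pi : topological_flow T X.

(** The points whose orbit meets a given nonempty open set form an open set,
    dense by transitivity; intersect these sets over a countable pi-base. *)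
Lemma transitive_point (x0 : X) : polish_space R X ->
  topologically_transitive pi -> exists y, dense (flow_orbit pi y).
Proof.
move=> [sepX [d [md zd cd]]] tr.
have [B [B0 Bbase]] := countable_pi_base md zd x0 sepX.
have [||y yB] := baire md zd cd x0 (G := fun n => \bigcup_t (pi t @^-1` B n)).
- move=> n; apply: bigcup_open => t _; apply: open_act_preimage.
  exact: (B0 n).1.
- move=> n U U0 oU; have [t [x [Ux Bx]]] := tr U (B n) oU (B0 n).1 U0 (B0 n).2.
  by exists x; split=> //; exists t.
exists y => U U0 oU; have [n BU] := Bbase U oU U0.
have [t _ Bty] := yB n.
by exists (pi t y); split; [exact: BU|exists t].
Qed.

End Transitive.

Section Devaney.
Variables (R : realType) (T : topologicalGroupType) (X : topologicalType).
Variable pi : topological_flow T X.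
Hypotheses (hX : polish_space R X) (hT : abelian_group T)
  (hTd : discrete_group T) (hpi : devaney_chaotic pi).

Let hausX : hausdorff_space X.
Proof. by have [_ [d [md zd _]]] := hX; exact: metric_hausdorff md zd. Qed.

Lemma devaney_point : exists x0 : X, True.
Proof.
have [_ _ nmin] := hpi; apply: contrapT => h; apply: nmin => x.
by case: h; exists x.
Qed.

Lemma devaney_transitive_point : exists y, dense (flow_orbit pi y).
Proof.
have [tr _ _] := hpi; have [x0 _] := devaney_point.
exact: transitive_point x0 hX tr.
Qed.

Lemma devaney_group_infinite : infinite_set [set: T].
Proof.
have [_ _ nmin] := hpi; have [y dy] := devaney_transitive_point.
move=> finT; apply: nmin; apply: dense_finite_orbit_minimal dy => //.
exact: finite_image.
Qed.

(** An isolated point would be periodic and would lie on the dense orbit, which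
    would then be finite. *)
Lemma devaney_perfect (O : set X) : open O -> O !=set0 ->
  exists a b, [/\ O a, O b & a <> b].
Proof.
move=> oO O0; have [_ dper nmin] := hpi.
have [y dy] := devaney_transitive_point.
have [z [Oz pz]] := dper O O0 oO.
apply: contrapT => h.
have Oz1 w : O w -> w = z.
  by move=> Ow; apply: contrapT => wz; apply: h; exists w, z.
have [_ [/Oz1 -> [t _ tz]]] := dy O O0 oO.
apply: nmin; apply: dense_finite_orbit_minimal dy => //.
apply: sub_finite_set (periodic_orbit_finite hTd pz) => _ [u _ <-].
by exists (u * t^-1)%g => //; rewrite -tz -flow_actM actK.
Qed.

(** [H] is the stabiliser of a periodic point [p0].  The translates of [H] by
    the inverses of a finite set [K] cover [T], so the closures [C k] of the sets
    [H k^-1 y0] cover [X]: one of them has nonempty interior, and one of them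
    contains [p0], though perhaps not the same one.  Translating [p0] from the
    latter into the former preserves its stabiliser because [T] is abelian. *)
Lemma proximal_region : exists (H : set T) (y p : X) (W : set X),
  [/\ forall h, H h -> pi h p = p, closure [set pi h y | h in H] p,
      open W, W !=set0 & W `<=` closure [set pi h y | h in H]].
Proof.
have [_ dper _] := hpi; have [y0 dy0] := devaney_transitive_point.
have [x0 _] := devaney_point.
have [p0 [_ [K /(discrete_compact_finite hTd) finK hK]]] :
  [set: X] `&` periodic_point pi !=set0
  by apply: dper; [exists x0|exact: openT].
pose H : set T := [set h | pi h p0 = p0].
pose C k := closure [set pi (h * k^-1)%g y0 | h in H].
have cov x : exists2 k, K k & C k x.
  have clC : closed (\bigcup_(k in K) C k).
    by apply: closed_bigcup => // k _; exact: closed_closure.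
  apply: contrapT => nx; have [||z [nz]] := dy0 (~` \bigcup_(k in K) C k).
  - by exists x => -[k Kk Ckx]; apply: nx; exists k.
  - exact: closed_openC.
  move=> [t _ tz]; apply: nz; have [_ [[k Kk <-] /= ktp]] := hK t.
  exists k => //; apply: subset_closure; exists (k * t)%g => //.
  by rewrite -tz hT mulKg.
have [s Ks] : exists s : seq T, K = [set` s] by apply/finite_seqP.
have [||||k ks Wk] := @interior_of_cover _ _ C s [set: X].
- by move=> k; exact: closed_closure.
- exact: openT.
- by exists x0.
- by move=> x _; have [k] := cov x; rewrite Ks; exists k.
have [k' Kk' Ck'] := cov p0.
have CE :
    [set pi h (pi k^-1%g y0) | h in H] = [set pi (h * k^-1)%g y0 | h in H].
  by apply/seteqP; split=> _ [h Hh <-]; exists h; rewrite ?flow_actM.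
exists H, (pi k^-1%g y0), (pi (k^-1 * k')%g p0), ((C k)^°); split=> //.
- by move=> h Hh; rewrite flow_actM hT -flow_actM Hh.
- rewrite CE => N Np.
  have [_ [[h Hh <-] Nh]] :=
    Ck' _ (@act_continuous _ _ pi (k^-1 * k')%g p0 _ Np).
  exists (pi (h * k^-1)%g y0); split; first by exists h.
  move: Nh; rewrite /= flow_actM; congr (N (pi _ y0)).
  by rewrite (hT h) -mulgA mulVKg hT.
- exact: open_interior.
- by rewrite CE; exact: interior_subset.
Qed.

(** The sets [U i] contain points [h i y] of a single orbit, so moving [y] close
    enough to the fixed point [p] of [H] moves all of them close to [p]. *)
Lemma simultaneous_proximality : exists (p : X) (W : set X),
  [/\ open W, W !=set0 & forall (I : finType) (U : I -> set X) (N : set X),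
    (forall i, [/\ open (U i), U i !=set0 & U i `<=` W]) -> nbhs p N ->
    exists t, forall i, exists2 x, U i x & N (pi t x)].
Proof.
have [H [y [p [W [Hp clp oW W0 Wcl]]]]] := proximal_region.
exists p, W; split=> // I U N PU Np.
have /choice[h Hh] i : exists h, H h /\ U i (pi h y).
  have [oU [x Ux] UW] := PU i.
  have [|_ [[h Hh <-] Uh]] := Wcl x (UW x Ux) (U i); last by exists h.
  exact: open_nbhs_nbhs.
have Np' : nbhs p [set x | forall i, N (pi (h i) x)].
  apply: (@filter_forall _ _ (fun i x => N (pi (h i) x))) => i.
  by apply: (@act_continuous _ _ pi (h i) p); rewrite Hp//; exact: (Hh i).1.
have [_ [[t _ <-] /= Nt]] := clp _ Np'.
exists t => i; exists (pi (h i) y); first exact: (Hh i).2.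
by have := Nt i; rewrite !flow_actM (hT t).
Qed.

Lemma simultaneous_recurrence (I : finType) (U : I -> set X) (F : set T) :
  (forall i, open (U i) /\ U i !=set0) -> finite_set F ->
  exists2 s, ~ F s & forall i, exists2 q, U i q & pi s q = q.
Proof.
have [_ dper _] := hpi.
move=> PU finF; have /choice[q Pq] i : exists q, U i q /\ periodic_point pi q.
  by have [oU U0] := PU i; have [q] := dper (U i) U0 oU; exists q.
have [||s nFs sq] := @periodic_fixed_outside _ _ pi hTd F (codom q) _ _ finF.
- by move=> _ /codomP[i ->]; exact: (Pq i).2.
- exact: devaney_group_infinite.
by exists s => // i; exists (q i); [exact: (Pq i).1|rewrite sq ?codom_f].
Qed.

(** A strong form of the conclusion: the two sequences and the limit point do
    not depend on the chosen points of the set. *)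
Lemma uniform_li_yorke_set (F : nat -> set T) : (forall n, finite_set (F n)) ->
  exists (Theta : set X) (s t : nat -> T) (p : X),
    [/\ ~ countable Theta, forall n, ~ F n (s n),
      forall x, Theta x -> (fun n => pi (s n) x) @ \oo --> x &
      forall x, Theta x -> (fun n => pi (t n) x) @ \oo --> p].
Proof.
move=> finF; have [_ [d [md zd cd]]] := hX.
have [p [W [oW W0 prox]]] := simultaneous_proximality.
pose E n (st : T * T) x := [/\ ~ F n st.1, (d (pi st.1 x) x < n.+1%:R^-1)%R
  & (d (pi st.2 x) p < n.+1%:R^-1)%R].
have [|c [Y [ncT ET]]] :=
  cantor_scheme md zd cd (E := E) oW W0 devaney_perfect.
  move=> n I U PU; set e : R := (n.+1%:R^-1)%R.
  have e0 : (0 < e)%R by rewrite invr_gt0.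
  have [t tp] := prox I U _ PU (nbhs_dist_lt zd p e0).
  pose U1 i := U i `&` (pi t @^-1` [set x | (d p x < e)%R]).
  have oU1 i : open (U1 i).
    have [oU _ _] := PU i; apply: openI => //.
    by apply: open_act_preimage; exact: open_dist_lt md zd _ _.
  have [|s nFs sq] := @simultaneous_recurrence I U1 (F n) _ (finF n).
    by move=> i; split=> //; have [x] := tp i; exists x.
  have /choice[q Pq] i : exists q, U1 i q /\ pi s q = q.
    by have [q] := sq i; exists q.
  (* If x and s x both lie within e/2 of the fixed point q i of s, then s moves
     x by less than e. *)
  pose A i := [set x | (d (q i) x < e / 2)%R].
  have qA i : A i (q i).
    by have [_ dE _ _] := md; rewrite /A /= (iffRL (dE _ _) erefl) divr_gt0.
  have oA i : open (A i) by exact: open_dist_lt md zd _ _.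
  exists (s, t), (fun i => U1 i `&` (A i `&` pi s @^-1` A i)) => i; split.
  - apply: openI => //; apply: openI => //; exact: open_act_preimage.
  - exists (q i); split; first exact: (Pq i).1.
    by split=> //=; rewrite (Pq i).2.
  - by move=> x [[]].
  - have [_ _ dC dtri] := md.
    move=> x [[_ /= tx] [/= xA sxA]]; split=> //=; last by rewrite dC.
    have := dtri (pi s x) (q i) x.
    by move: xA sxA; rewrite (dC _ (q i)) /A /= -/e; lra.
have [x Tx] : Y !=set0.
  by apply/set0P/eqP => T0; apply: ncT; rewrite T0.
exists Y, (fun n => (c n).1), (fun n => (c n).2), p; split=> //.
- by move=> n; have [] := ET x Tx n.
- by move=> z Tz; apply: (cvg_of_dist_lt md zd) => n; have [] := ET z Tz n.
- by move=> z Tz; apply: (cvg_of_dist_lt md zd) => n; have [] := ET z Tz n.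
Qed.

End Devaney.

Theorem proposition2p21 (R : realType) (T : topologicalGroupType)
    (X : topologicalType) (pi : topological_flow T X)
    (hX : polish_space R X)
    (hT : abelian_group T) (hTd : discrete_group T) :
  devaney_chaotic pi -> multidim_li_yorke_chaotic pi.
Proof.
move=> hpi F cF _.
have [Y [s [t [p [ncT nF recs proxt]]]]] :=
  uniform_li_yorke_set hX hT hTd hpi
    (fun n => discrete_compact_finite hTd (cF n)).
exists Y => // k x _ Tx _; exists s, t, p; split=> //.
- by apply: cvg_coordinatewise => i; exact: recs (Tx i).
- by apply: cvg_coordinatewise => i; exact: proxt (Tx i).
Qed.
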